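(* Suppose $\mathcal{X}$ is an infinite-dimensional discrete function space on a tree $T$. If the composition operator $C_b$ is not invertible on $\mathcal{X}$, then the differentiation operator $D$ is not compact on $\mathcal{X}$.
   Context: A tree $T$ is a locally finite, connected, simply-connected graph, identified with its set of vertices. A vertex is terminal if it has a unique neighbor; all trees are assumed to be without terminal vertices (hence infinite) and rooted at a vertex $o$. For $v\neq o$, $v^-$ denotes the unique neighbor of $v$ lying on the path from $o$ to $v$ (the parent of $v$). A function on $T$ is a complex-valued function on its vertices. The backward shift map $b:T\to T$ is $b(v)=v^-$ for $v\neq o$ and $b(o)=o$. The derivative of $f:T\to\mathbb{C}$ is $f'(v)=f(v)-f(b(v))$ for all $v\in T$ (so $f'(o)=0$). A functional Banach space on a set $\Omega$ is a Banach space of complex-valued functions on $\Omega$ with pointwise vector operations, such that $f(x)=g(x)$ for all $x\in\Omega$ implies $f=g$, $f(x)=f(y)$ for every $f$ in the space implies $x=y$, and for each $x\in\Omega$ the linear functional $f\mapsto f(x)$ is continuous. A discrete function space $\mathcal{X}$ on $T$ is a functional Banach space whose elements are functions on $T$, with norm $\|\cdot\|_{\mathcal{X}}$. The differentiation operator is $Df=f'$, and the composition operator induced by $b$ is $C_bf=f\circ b$. $C_b$ is invertible on $\mathcal{X}$ if it is a bounded operator from $\mathcal{X}$ to $\mathcal{X}$ with a bounded inverse. $D$ is compact on $\mathcal{X}$ if it maps $\mathcal{X}$ into $\mathcal{X}$ and for every bounded sequence $\{x_n\}$ in $\mathcal{X}$ the sequence $\{Dx_n\}$ has a convergent subsequence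 in $\mathcal{X}$. *)

(* Defs.v *)
From mathcomp Require Import all_boot all_order all_algebra.
From mathcomp Require Import complex.
From mathcomp Require Import all_classical all_reals all_analysis.

Set Implicit Arguments.
Unset Strict Implicit.
Unset Printing Implicit Defensive.

Import Order.TTheory GRing.Theory Num.Theory.
Import numFieldNormedType.Exports.

Local Open Scope classical_set_scope.
Local Open Scope ring_scope.
Local Open Scope complex_scope.

(* [p] lists the vertices after [u] of a path from [u] to [v] that does not
   repeat a vertex. *)
Definition simple_path (V : choiceType) (adj : rel V) (u v : V) (p : seq V) :=
  [/\ path adj u p, last u p = v & uniq (u :: p)].

Definition terminal (V : choiceType) (adj : rel V) (v : V) : Prop :=
  exists! w, adj v w.

(* Simple connectedness of a graph is the absence of cycles; [ucycle adj c]
   also holds when [c] is empty or runs back and forth along a single edge,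
   hence the bound on [size c]. *)
Record rootedTree := RootedTree {
  vertex :> choiceType;
  adj : rel vertex;
  root_vertex : vertex;
  adj_sym : symmetric adj;
  adj_irr : irreflexive adj;
  adj_locally_finite : forall v, finite_set [set w | adj v w];
  adj_connected : forall u v, exists p, path adj u p /\ last u p = v;
  adj_acyclic : forall c : seq vertex, ucycle adj c -> (size c <= 2)%N;
  adj_no_terminal : forall v, ~ terminal adj v }.

(* The neighbor of [v] on the path from the root to [v]; for [v] the root that
   path is reduced to [v], the set below is empty, and the value is the root. *)
Definition backward_shift (T : rootedTree) (v : T) : T :=
  xget (root_vertex T)
    [set w : T | adj v w /\
       exists p, simple_path (@adj T) (root_vertex T) v p /\
                 w \in root_vertex T :: p].

(* The points of the space are abstract and [fbs_eval f] is the function that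
   [f] stands for; [fbs_eval_inj] makes the space a space of functions.
   Norms of a normed module over [R[i]] have values in [R[i]]; as they are
   nonnegative there, they are real. *)
Record functionalBanachSpace (R : realType) (Omega : Type) :=
  FunctionalBanachSpace {
  fbs_sort :> completeNormedModType R[i];
  fbs_eval : fbs_sort -> Omega -> R[i];
  fbs_eval_linear : forall (a : R[i]) (f g : fbs_sort) (x : Omega),
    fbs_eval (a *: f + g) x = a * fbs_eval f x + fbs_eval g x;
  fbs_eval_inj : forall f g : fbs_sort,
    (forall x, fbs_eval f x = fbs_eval g x) -> f = g;
  fbs_separates : forall x y : Omega,
    (forall f, fbs_eval f x = fbs_eval f y) -> x = y;
  fbs_eval_continuous : forall x : Omega,
    continuous (fun f : fbs_sort => fbs_eval f x : R[i]^o) }.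

Definition discreteFunctionSpace (R : realType) (T : rootedTree) :=
  functionalBanachSpace R T.

Definition finite_dimensional (K : fieldType) (V : lmodType K) : Prop :=
  exists (n : nat) (e : 'I_n -> V),
    forall x : V, exists a : 'I_n -> K, x = \sum_(i < n) a i *: e i.

Definition derivative (R : realType) (T : rootedTree) (f : T -> R[i]) :
    T -> R[i] :=
  fun v => f v - f (backward_shift v).

Definition comp_shift (R : realType) (T : rootedTree) (f : T -> R[i]) :
    T -> R[i] :=
  f \o @backward_shift T.

(* [A] is the action on [X] of the map [Phi] on functions. Such an [A] exists
   exactly when [Phi] maps [X] into [X], and it is then unique. *)
Definition acts_as (R : realType) (Omega : Type)
    (X : functionalBanachSpace R Omega)
    (Phi : (Omega -> R[i]) -> (Omega -> R[i])) (A : X -> X) : Prop :=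
  forall f : X, fbs_eval (A f) = Phi (fbs_eval f).

Definition bounded_operator (K : numFieldType) (V : normedModType K)
    (A : {linear V -> V}) : Prop :=
  exists M : K, forall x : V, `|A x| <= M * `|x|.

Definition compact_operator (K : numFieldType) (V : normedModType K)
    (A : {linear V -> V}) : Prop :=
  forall x_ : nat -> V, bounded_fun x_ ->
    exists phi : nat -> nat, increasing_seq phi /\
      exists l : V, A (x_ (phi n)) @[n --> \oo] --> l.

Definition invertible_on (R : realType) (Omega : Type)
    (X : functionalBanachSpace R Omega)
    (Phi : (Omega -> R[i]) -> (Omega -> R[i])) : Prop :=
  exists A B : {linear X -> X},
    [/\ acts_as Phi A, bounded_operator A, bounded_operator B,
        cancel A B & cancel B A].

Definition compact_on (R : realType) (Omega : Type)
    (X : functionalBanachSpace R Omega)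
    (Phi : (Omega -> R[i]) -> (Omega -> R[i])) : Prop :=
  exists A : {linear X -> X}, acts_as Phi A /\ compact_operator A.

(* Main.v *)
From HB Require Import structures.
Require Import Defs.
From mathcomp Require Import all_boot all_order all_algebra.
From mathcomp Require Import complex.
From mathcomp Require Import all_classical all_reals all_analysis.

(** On functions, differentiation is the identity minus composition with the
    backward shift [b], so that C_b = I - D.  Hence if [D] is compact, then
    C_b is a compact perturbation of the identity, and the Fredholm alternative
    reduces its invertibility to its injectivity.  Injectivity is combinatorial:
    in a tree without terminal vertices every vertex other than the root has a
    child, and the root is its own shift, so [b] is surjective ([backward_shift_surj]) and
    f o b = 0 forces f = 0.

    The injective case of the Fredholm alternative ([perturbed_id_invertible])
    is proved along F. Riesz's lines.  Let B = I - C with [C] compact and [B]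
    injective.
    - If [x_n] is bounded and [B x_n] converges, then, along a subsequence,
      [C x_n] converges, hence so does x_n = B x_n + C x_n
      ([perturbed_id_proper]).
    - Applied to unit vectors with [B x_n] tending to 0, this contradicts
      injectivity: [B] is bounded below.  Applied to approximate preimages of
      a vector, it then shows that the range of [B] is closed.
    - If some [y] is not in that range, then [B^k y] stays at positive distance
      from the range of [B^(k+1)], because [B^k] is bounded below.  Riesz's
      lemma gives unit vectors [e_k] in the range of [B^k] at distance at least
      1/2 from the range of [B^(k+1)].  For n < m the vector C e_n - C e_m is
      [e_n] minus an element of the range of [B^(n+1)], so [C e_k] has no
      Cauchy subsequence, against compactness ([perturbed_id_surjective]).

    Distances are compared without taking infima.  Norms over the complex
    numbers have values in a field that is only partially ordered, so the almost
    closest point of Riesz's lemma is found by iterating (if no point is within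
    a factor 2 of being the closest, distances can be halved for ever).  This
    is why the scalars are asked to be archimedean, and not to be real or
    complex numbers. *)

Set Implicit Arguments.
Unset Strict Implicit.
Unset Printing Implicit Defensive.

Import Order.TTheory GRing.Theory Num.Theory.
Import numFieldNormedType.Exports.

Local Open Scope classical_set_scope.
Local Open Scope ring_scope.

(** * Surjectivity of the backward shift *)

Section RootedTree.
Context (T : rootedTree).
Implicit Types u v w : T.

(** A walk between two different neighbors of [w] that avoids [w] would close up
    through [w] into a cycle. *)
Lemma neighbors_linked_off w u v (p : seq T) :
  adj w u -> adj w v -> path (@adj T) u p -> last u p = v ->
  w \notin u :: p -> u = v.
Proof.
move=> wu wv up uv wp; case: (shortenP up) uv => q uq Uq sqp uv.
have wq : w \notin u :: q.
  by apply: contra wp; rewrite !inE => /orP[->//|/sqp ->]; rewrite orbT.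
case: q => [|a q] in uq Uq sqp uv wq *; first exact: uv.
suff /(@adj_acyclic T) : ucycle (@adj T) (w :: u :: a :: q) by [].
apply/andP; split; last by rewrite cons_uniq wq.
by move: uq uv => /= /andP[-> uq] uv; rewrite rcons_path /= wu uv uq adj_sym.
Qed.

(** The same vertex as in [backward_shift]: reaching [u] from the root
    by a walk that avoids [v] is easier to transport than lying on a simple path
    to [v]. *)
Definition parent v u :=
  adj v u /\ exists p, [/\ path (@adj T) (root_vertex T) p,
    last (root_vertex T) p = u & v \notin root_vertex T :: p].

(** The walks from the root to two parents of [v] join into a walk between them
    that avoids [v]. *)
Lemma parent_unique v u w : parent v u -> parent v w -> u = w.
Proof.
move=> [vu [p [op pu vp]]] [vw [q [oq qw vq]]].
apply: (@neighbors_linked_off v u w (rev (belast (root_vertex T) p) ++ q)) => //.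
- rewrite cat_path -pu rev_path (eq_path (e' := @adj T)); last first.
    by move=> x y; rewrite /= adj_sym.
  rewrite op /=; case: p {op pu vp} => [|a p] //=.
  by rewrite rev_cons last_rcons.
- rewrite last_cat -[RHS]qw; congr last; rewrite -pu.
  by case: p {op pu vp} => [|a p] //=; rewrite rev_cons last_rcons.
- rewrite -pu -cat_cons mem_cat -rev_rcons -lastI mem_rev negb_or vp /=.
  by apply: contra vq; rewrite inE orbC => ->.
Qed.

(** A simple path to [v], cut at a neighbor of [v], avoids [v]: the set that
    defines the shift consists of parents.  It is not empty, as any walk to the
    parent that avoids [v] shortens to a simple path that extends to [v]. *)
Lemma backward_shift_unique v u :
  parent v u -> backward_shift v = u.
Proof.
have sub : [set w : T | adj v w /\ exists p,
    simple_path (@adj T) (root_vertex T) v p /\ w \in root_vertex T :: p]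
    `<=` parent v.
  move=> w [vw [p [[op pv Up] wp]]]; split=> //.
  have wv : w != v by apply: contraTneq vw => ->; rewrite adj_irr.
  case/splitPl: wp => p1 p2 p1w in op pv Up *.
  exists p1; split=> //; first by move: op; rewrite cat_path => /andP[].
  move: Up; rewrite -cat_cons cat_uniq => /and3P[_ /hasPn disj _].
  apply: disj; move: pv; rewrite last_cat p1w.
  by case: p2 {op} => [/eqP|a p2 /= <-]; [rewrite (negPf wv)|rewrite mem_last].
move=> vu; apply: parent_unique (vu); apply: sub; apply: xgetPex.
case: vu => vu [p [op pu vp]]; exists u; split=> //.
case: (shortenP op) pu => q oq Uq sqp qu.
have vq : v \notin root_vertex T :: q.
  by apply: contra vp; rewrite !inE => /orP[->//|/sqp ->]; rewrite orbT.
exists (rcons q v); split; first split.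
- by rewrite rcons_path oq qu adj_sym.
- by rewrite last_rcons.
- by rewrite -rcons_cons rcons_uniq vq.
- by rewrite -rcons_cons mem_rcons inE -qu mem_last orbT.
Qed.

Lemma backward_shift_root : backward_shift (root_vertex T) = root_vertex T.
Proof.
rewrite /backward_shift xgetPN// => w [ow [[|a p] [[_ po Up] wp]]].
  by move: ow; rewrite inE in wp; rewrite (eqP wp) adj_irr.
by move: Up; rewrite -po /= mem_last.
Qed.

(** Away from the root, [v] has besides its parent another neighbor [w]; as [w]
    is not a parent of [v], a simple path from the root to [v] avoids [w], which
    makes [v] the parent of [w]. *)
Lemma backward_shift_surj v : exists w, backward_shift w = v.
Proof.
have [->|v_neq0] := eqVneq v (root_vertex T).
  by exists (root_vertex T); exact: backward_shift_root.
have [p0 [op0 p0v]] := adj_connected (root_vertex T) v.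
case: (shortenP op0) p0v => p op Up _ pv {p0 op0}.
case/lastP: p => [|p v'] in op Up pv; first by rewrite -pv eqxx in v_neq0.
rewrite last_rcons in pv; subst v'.
rewrite rcons_path in op; case/andP: op => op uv.
rewrite -rcons_cons rcons_uniq in Up; case/andP: Up => vp Up.
set u := last _ p in uv.
have vu : parent v u by split; [rewrite adj_sym|exists p].
have [w vw wu] : exists2 w, adj v w & w <> u.
  apply: contrapT => noway; apply: (@adj_no_terminal T v); exists u; split.
    by rewrite adj_sym.
  move=> w vw; apply: contrapT => uw; apply: noway; exists w => // wu.
  exact: uw.
exists w; apply: backward_shift_unique; split; first by rewrite adj_sym.
exists (rcons p v); split; [by rewrite rcons_path op|by rewrite last_rcons|].
rewrite -rcons_cons mem_rcons inE negb_or; apply/andP; split.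
  by apply: contraTneq vw => ->; rewrite adj_irr.
apply/negP => wp; apply: wu; apply: parent_unique vu; split=> //.
case/splitPl: wp => p1 p2 p1w in op vp *; exists p1; split=> //.
  by move: op; rewrite cat_path => /andP[].
by apply: contra vp; rewrite -cat_cons mem_cat => ->.
Qed.

End RootedTree.

(** * Archimedean scalars and Riesz's lemma *)

Lemma complex_archimedean (R : realType) : Num.archimedean_axiom R[i].
Proof.
move=> z; exists (Num.bound (complex.Re `|z|)).
have zR : (complex.Re `|z|)%:C%C = `|z| by apply: RRe_real; rewrite normr_real.
rewrite -[X in X < _]zR -(rmorph_nat (real_complex R)) ltcR.
apply: archi_boundP; rewrite -lecR zR.
exact: normr_ge0.
Qed.

Section Archimedean.
Context (K : numFieldType) (archK : Num.archimedean_axiom K).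

Lemma harmonic_small (e : K) : 0 < e ->
  exists N, forall n, (N <= n)%N -> n.+1%:R^-1 < e.
Proof.
move=> e0; have [N] := archK e^-1; rewrite gtr0_norm ?invr_gt0// => eN.
exists N => n Nn; rewrite invf_plt ?posrE ?ltr0n//.
by apply: lt_le_trans eN _; rewrite ler_nat leqW.
Qed.

(** If every value could be beaten by a factor 2, iterating would bring the
    values below [d]. *)
Lemma half_minimizer (S : Type) (f : S -> K) (d : K) (s0 : S) : 0 < d ->
  (forall s, d <= f s) -> exists s, forall t, f s <= 2 * f t.
Proof.
move=> d0 df; have f0 s : 0 < f s by exact: lt_le_trans d0 (df s).
apply: contrapT => nomin.
have /choice[g fg] : forall s, exists t, 2 * f t < f s.
  move=> s; apply: contrapT => nos; apply: nomin; exists s => t.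
  rewrite real_leNgt ?gtr0_real ?mulr_gt0//.
  by apply/negP => st; apply: nos; exists t.
have fiter n : 2 ^+ n * f (iter n g s0) <= f s0.
  elim: n => [|n IHn]; first by rewrite mul1r.
  apply: le_trans IHn; rewrite exprSr -mulrA.
  by rewrite ler_pM2l ?exprn_gt0//=; exact: ltW.
have [N] := archK (f s0 / d); rewrite gtr0_norm ?divr_gt0// ltr_pdivrMr//.
apply/negP; rewrite le_gtF//; apply: le_trans (fiter N).
apply: ler_pM => //; first exact: ltW.
by rewrite -natrX ler_nat ltnW// ltn_expl.
Qed.

End Archimedean.

(** The range of [L] plays the part of the subspace, and the unit vector is
    obtained by normalizing the difference of [v] and an almost closest point of
    that range. *)
Lemma riesz_lemma (K : numFieldType) (archK : Num.archimedean_axiom K)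
    (W : lmodType K) (V : normedModType K) (L : {linear W -> V}) (v : V) (d : K) :
  0 < d -> (forall w, d <= `|v - L w|) ->
  exists a w, `|a *: v - L w| = 1 /\
    forall t, 2^-1 <= `|a *: v - L w - L t|.
Proof.
move=> d0 dist_ge; have [w wP] := half_minimizer archK 0 d0 dist_ge.
set r := `|v - L w| in wP; have r0 : 0 < r by exact: lt_le_trans d0 (dist_ge w).
exists r^-1, (r^-1 *: w); rewrite linearZ_LR -scalerBr; split=> [|t].
  by rewrite normrZ gtr0_norm ?invr_gt0// mulVf ?gt_eqF.
rewrite -[L t](scalerK (lt0r_neq0 r0)) -scalerBr normrZ gtr0_norm ?invr_gt0//.
rewrite ler_pdivlMl// ler_pdivrMr// mulrC.
by apply: le_trans (wP (w + r *: t)) _; rewrite linearD linearZ_LR opprD addrA.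
Qed.

(** * Compact perturbations of the identity *)

Lemma iter_linear (K : pzRingType) (V : lmodType K) (f : {linear V -> V}) k :
  linear (iter k f).
Proof. by elim: k => [|k IHk] a u v; rewrite // !iterS IHk linearP. Qed.

Lemma increasing_seq_ge (phi : nat -> nat) n : increasing_seq phi -> (n <= phi n)%N.
Proof.
move=> phi_incr; elim: n => // n IHn; apply: leq_ltn_trans IHn _.
by rewrite (leqW_mono phi_incr) ltnSn.
Qed.

Lemma increasing_seq_cvgy (phi : nat -> nat) : increasing_seq phi ->
  phi n @[n --> \oo] --> \oo.
Proof.
move=> phi_incr A [N _ NA]; exists N => // n /= Nn.
by apply: NA; apply: leq_trans Nn (increasing_seq_ge n phi_incr).
Qed.

Section CompactPerturbation.
Context (K : numFieldType) (archK : Num.archimedean_axiom K).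
Context (V : normedModType K) (C : {linear V -> V}).
Context (Ccompact : compact_operator C).

Lemma bounded_seq (x_ : nat -> V) M : (forall n, `|x_ n| <= M) -> bounded_fun x_.
Proof.
move=> xM; apply/(ex_bound x_); last by exists M => n _; exact: xM.
exact: (@globally_properfilter _ _ 0%N).
Qed.

(** Unit vectors [x_n] with [C x_n] larger than [n] have no subsequence along
    which [C x_n] is bounded. *)
Lemma compact_operator_bounded : bounded_operator C.
Proof.
apply: contrapT => unbdd.
have /choice[x xP] : forall n, exists x : V, `|x| = 1 /\ n%:R < `|C x|.
  move=> n; apply: contrapT => nox; apply: unbdd; exists n%:R => x.
  rewrite real_leNgt ?normr_real ?realM ?realn ?normr_real//.
  apply/negP => nx; apply: nox.
  have x0 : 0 < `|x|.
    by rewrite normr_gt0; apply: contraTneq nx => ->; rewrite linear0 !normr0 mulr0 ltxx.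
  exists (`|x|^-1 *: x); rewrite linearZ /= !normrZ gtr0_norm ?invr_gt0//.
  by rewrite mulVf ?gt_eqF// mulrC ltr_pdivlMr.
have [|phi [phi_incr [l Cl]]] := Ccompact (x_ := x).
  by apply: (@bounded_seq _ 1) => n; rewrite (xP n).1.
have [M [N _ NM]] := (ex_bound _).1 (cvg_bounded _ _ Cl).
have [k kM] := archK M.
have := NM (maxn N k) (leq_maxl _ _) => /=; apply/negP.
have Mlt : M < `|C (x (phi (maxn N k)))|.
  apply: le_lt_trans (xP _).2; apply: le_trans (real_ler_norm _) _.
    by rewrite (ger0_real (le_trans _ (NM N (leqnn N)))) //= normr_ge0.
  apply: le_trans (ltW kM) _; rewrite ler_nat.
  exact: leq_trans (leq_maxr N k) (increasing_seq_ge _ phi_incr).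
by rewrite lt_geF.
Qed.

Lemma compact_operator_continuous : continuous C.
Proof.
have [M CM] := compact_operator_bounded.
apply/bounded_linear_continuous/bounded_funP => r; exists (`|M| * r) => x xr.
apply: le_trans (ler_wpM2l (normr_ge0 M) xr).
by rewrite -[`|x|]normr_id -normrM ger0_norm// (le_trans _ (CM x)).
Qed.

Lemma cvg_harmonic_dist (x_ : nat -> V) y :
  (forall n, `|y - x_ n| < n.+1%:R^-1) -> x_ n @[n --> \oo] --> y.
Proof.
move=> xy; apply/cvgrPdist_lt => e e0; have [N Ne] := harmonic_small archK e0.
by exists N => // n /= Nn; apply: lt_trans (xy n) (Ne n Nn).
Qed.

Definition perturbed_id : {linear V -> V} := idfun \- C.
Local Notation B := perturbed_id.

(** Compactness controls [C x_n], and x_n = (x_n - C x_n) + C x_n: this is how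
    solutions of [x - C x = y] are obtained from approximate ones. *)
Lemma perturbed_id_proper (x_ : nat -> V) (y : V) :
  bounded_fun x_ -> x_ n - C (x_ n) @[n --> \oo] --> y ->
  exists phi : nat -> nat, exists x : V,
    x_ (phi n) @[n --> \oo] --> x /\ x - C x = y.
Proof.
move=> xb xy; have [phi [phi_incr [l Cl]]] := Ccompact xb.
have xphi : x_ (phi n) @[n --> \oo] --> y + l.
  rewrite (_ : (fun n => x_ (phi n)) =
    (fun n => (x_ (phi n) - C (x_ (phi n))) + C (x_ (phi n)))); last first.
    by apply/funext => n; rewrite subrK.
  apply: cvgD Cl; exact: (cvg_comp _ _ (increasing_seq_cvgy phi_incr) xy).
exists phi, (y + l); split=> //.
suff -> : C (y + l) = l by rewrite addrK.
apply: cvg_unique Cl; first exact: norm_hausdorff.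
apply: (cvg_comp _ _ xphi); exact: compact_operator_continuous.
Qed.

Context (fixC : forall x, C x = x -> x = 0).

(** Unit vectors [x_n] with [x_n - C x_n] tending to 0 would accumulate at a unit
    vector fixed by [C]. *)
Lemma perturbed_id_bounded_below :
  exists2 c : K, 0 < c & forall x, c * `|x| <= `|x - C x|.
Proof.
apply: contrapT => nobelow.
have /choice[x xP] : forall n, exists x : V, `|x| = 1 /\ `|x - C x| < n.+1%:R^-1.
  move=> n; apply: contrapT => nox; apply: nobelow; exists n.+1%:R^-1.
    by rewrite invr_gt0 ltr0n.
  move=> x; rewrite real_leNgt ?normr_real// ?realM ?realV ?realn ?normr_real//.
  apply/negP => nx; apply: nox.
  have x0 : 0 < `|x|.
    rewrite normr_gt0; apply: contraTneq nx => ->.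
    by rewrite linear0 subrr !normr0 mulr0 ltxx.
  exists (`|x|^-1 *: x); rewrite linearZ /= -scalerBr !normrZ gtr0_norm ?invr_gt0//.
  by rewrite mulVf ?gt_eqF// mulrC ltr_pdivrMr.
have [||phi [l [xl lC]]] := @perturbed_id_proper x 0.
- by apply: (@bounded_seq _ 1) => n; rewrite (xP n).1.
- by apply: cvg_harmonic_dist => n; rewrite sub0r normrN (xP n).2.
have l0 : l = 0 by apply: fixC; apply/esym/eqP; rewrite -subr_eq0 lC.
have /cvgrPdist_lt/(_ 1 ltr01)[N _ /(_ N (leqnn N))] := xl; rewrite l0 /=.
by rewrite sub0r normrN (xP _).1 ltxx.
Qed.

(** Since [x - C x] controls [x], approximate preimages of [y] form a bounded
    sequence. *)
Lemma perturbed_id_range_closed (y : V) :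
  (forall n, exists x, `|y - (x - C x)| < n.+1%:R^-1) ->
  exists x, x - C x = y.
Proof.
move=> /choice[x xP]; have [c c0 cP] := perturbed_id_bounded_below.
have [||phi [l [_ ly]]] := @perturbed_id_proper x y; last by exists l.
- apply: (@bounded_seq _ ((`|y| + 1) / c)) => n; rewrite ler_pdivlMr// mulrC.
  apply: le_trans (cP _) _; rewrite -[X in `|X| <= _](subKr y).
  apply: le_trans (ler_normB _ _) _; rewrite lerD2l.
  by apply: le_trans (ltW (xP n)) _; rewrite invf_le1 ?ltr0n// ler1n.
- exact: cvg_harmonic_dist.
Qed.

(** Otherwise the ranges of the powers of [B] decrease strictly, with a gap at
    each step that Riesz's lemma turns into a sequence whose image under [C] has
    no Cauchy subsequence. *)
Lemma perturbed_id_surjective (y : V) : exists x, x - C x = y.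
Proof.
apply: contrapT => yB; have [c c0 cB] := perturbed_id_bounded_below.
pose Bn k : {linear V -> V} :=
  HB.pack (iter k B) (GRing.isLinear.Build _ _ _ _ _ (iter_linear B k)).
have BnSr k (t : V) : Bn k.+1 t = Bn k (B t) by exact: iterSr.
have BnS k (t : V) : Bn k.+1 t = B (Bn k t) by exact: iterS.
have Bn_below k x : c ^+ k * `|x| <= `|Bn k x|.
  elim: k => [|k IHk]; first by rewrite mul1r.
  by rewrite exprS -mulrA (le_trans _ (cB _))// ler_pM2l.
(* A bound [d] exists because the range of [B] is closed. *)
have [d d0 dB] : exists2 d : K, 0 < d & forall u, d <= `|y - B u|.
  apply: contrapT => nod; apply: yB; apply: perturbed_id_range_closed => n.
  apply: contrapT => nox; apply: nod; exists n.+1%:R^-1.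
    by rewrite invr_gt0 ltr0n.
  move=> u; rewrite real_leNgt ?realV ?realn ?normr_real//.
  by apply/negP => ul; apply: nox; exists u.
have /choice[s sP] : forall k, exists s : V, `|Bn k s| = 1 /\
    forall t, 2^-1 <= `|Bn k s - Bn k.+1 t|.
  move=> k; have ckd : 0 < c ^+ k * d by rewrite mulr_gt0 ?exprn_gt0.
  have [|a [w]] := @riesz_lemma _ archK _ _ (Bn k.+1) (Bn k y) _ ckd.
    move=> w; rewrite BnSr -linearB; apply: le_trans (Bn_below _ _).
    by rewrite ler_pM2l ?exprn_gt0.
  by rewrite BnSr -linearZ_LR -linearB; exists (a *: y - B w).
have [|phi [phi_incr [l Cl]]] := Ccompact (x_ := fun k => Bn k (s k)).
  by apply: (@bounded_seq _ 1) => k; rewrite (sP k).1.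
have e0 : 0 < 2^-1 / 2 :> K by rewrite !divr_gt0.
have /cvgrPdist_lt/(_ _ e0)[N _ NP] := Cl.
have lt_phi : (phi N < phi N.+1)%N by rewrite (leqW_mono phi_incr) ltnSn.
set n := phi N in lt_phi; set m := phi N.+1 in lt_phi.
have : `|C (Bn n (s n)) - C (Bn m (s m))| < 2^-1.
  rewrite [ltRHS]splitr; apply: le_lt_trans (ler_distD l _ _) _.
  by apply: ltrD; [rewrite distrC|]; apply: NP => /=.
apply/negP; rewrite le_gtF//.
have [j mE] : exists j, m = (n.+1 + j)%N by exists (m - n.+1)%N; rewrite subnKC.
(* With [e_k := Bn k (s k)] and [e_m = Bn n.+1 t], the difference
   [C e_n - C e_m] is [e_n - Bn n.+1 (s n + (t - B t))]. *)
have CE u : C u = u - B u by rewrite [B u]/(u - C u) subKr.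
have BmE : Bn m (s m) = Bn n.+1 (Bn j (s m)) by rewrite {1}mE; exact: iterD.
move: (Bn j (s m)) BmE => t BmE.
apply: le_trans ((sP n).2 (s n + (t - B t))) _.
rewrite !CE BmE -(BnS n) -(BnS n.+1) (BnSr n.+1) -linearB.
by rewrite -addrA -opprD -linearD.
Qed.

(** The injective case of the Fredholm alternative; the bound from below on [B]
    is a bound on its inverse. *)
Theorem perturbed_id_invertible :
  exists B' : {linear V -> V},
    [/\ bounded_operator B, bounded_operator B', cancel B B' & cancel B' B].
Proof.
have /choice[g gK] := perturbed_id_surjective.
have Bg : cancel g B by exact: gK.
have [c c0 cB] := perturbed_id_bounded_below.
have Binj : injective B.
  move=> u v /eqP; rewrite -subr_eq0 -linearB /= => /eqP uv.
  apply/eqP; rewrite -subr_eq0; apply/eqP/fixC/esym/eqP.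
  by rewrite -subr_eq0; apply/eqP; exact: uv.
have gB : cancel B g by move=> u; apply: Binj; rewrite Bg.
pose g' : {linear V -> V} :=
  HB.pack g (GRing.isLinear.Build _ _ _ _ g (can2_linear gB Bg)).
exists g'; split=> //.
  have [M CM] := compact_operator_bounded; exists (1 + M) => x.
  by rewrite mulrDl mul1r (le_trans (ler_normB _ _))// lerD2l CM.
exists c^-1 => x; rewrite ler_pdivlMl//.
by apply: le_trans (cB _) _; rewrite -[X in _ <= `|X|](Bg x).
Qed.

End CompactPerturbation.

(** * The theorem *)

Section FunctionalBanachSpace.
Context (R : realType) (Omega : Type) (X : functionalBanachSpace R Omega).

Lemma fbs_evalB (f g : X) x : fbs_eval (f - g) x = fbs_eval f x - fbs_eval g x.
Proof. by rewrite addrC -scaleN1r fbs_eval_linear mulN1r addrC. Qed.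

Lemma fbs_eval0 x : fbs_eval (0 : X) x = 0.
Proof. by rewrite -(subrr 0) fbs_evalB subrr. Qed.

End FunctionalBanachSpace.

Theorem corollary2p22 (R : realType) (T : rootedTree)
    (X : discreteFunctionSpace R T) :
  ~ finite_dimensional X ->
  ~ invertible_on X (@comp_shift R T) ->
  ~ compact_on X (@derivative R T).
Proof.
move=> _ ninv [D [DE Dcompact]]; apply: ninv.
have fixD f : D f = f -> f = 0.
  move=> Df; apply: (@fbs_eval_inj _ _ X) => v; rewrite fbs_eval0.
  have [w <-] := backward_shift_surj v.
  have := congr1 (@fbs_eval _ _ X ^~ w) Df; rewrite /= DE /derivative.
  by move/eqP; rewrite subr_eq -subr_eq0 opprD addNKr oppr_eq0 => /eqP.
have [D' [bB bD' BD' D'B]] :=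
  perturbed_id_invertible (@complex_archimedean R) Dcompact fixD.
exists (perturbed_id D), D'; split=> // f; apply/funext => v.
by rewrite [perturbed_id D f]/(f - D f) fbs_evalB DE /derivative subKr.
Qed.
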